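(* Let $W$ be a finite irreducible Weyl group with simple reflections $\{s_k\mid k\in I\}$ and set of reflections $T$. Let $i\in I$ be such that $W^i$, the set of minimal length coset representatives of $W/W_{I\setminus\{i\}}$, is a distributive lattice under the left weak order restricted to $W^i$. Then the strong (Bruhat) order and the left weak order restricted to $W^i$ coincide. In particular the edge-labeled posets $W^i_{\mathrm{weak}}$ and $W^i_{\mathrm{strong}}$ are distributively labeled lattices.
   Context: Here $W^J=\{w\in W\mid w<ws_j\text{ for all }j\in J\}$ for $J\subset I$, and $W_J$ is the subgroup generated by $s_j$, $j\in J$. The left weak order has covers $w\prec s_kw$ when $\ell(s_kw)=\ell(w)+1$; the strong order has covers $w\lessdot wt$ with $t\in T$ and $\ell(wt)=\ell(w)+1$. $W^i_{\mathrm{weak}}$ is $W^i$ with the left weak order and each cover $w\prec s_kw$ labeled by $s_k$; $W^i_{\mathrm{strong}}$ is $W^i$ with the strong order and each cover $w\lessdot wt$ labeled by $t$. For a finite poset $Q$, $J(Q)$ is the lattice of lower order ideals. An edge-labeled poset $(P,\omega)$, with $\omega$ labeling the covers of $P$ by elements of a set $S$, is a distributively labeled lattice if $P\cong J(Q)$ for a finite poset $Q$ and there is a vertex labeling $\pi:Q\to S$ such that $\omega(I_0\setminus\{q\}\lessdot I_0)=\pi(q)$ for all $I_0\in J(Q)$ and $q$ maximal in $I_0$. *)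

(* Defs.v *)
From HB Require Import structures.
From mathcomp Require Import all_boot all_order all_algebra all_fingroup.
From mathcomp Require Import finmap.

Set Implicit Arguments.
Unset Strict Implicit.
Unset Printing Implicit Defensive.

Import Order.TTheory GRing.Theory Num.Theory.

Section RootSystems.
Variables (R : realFieldType) (n : nat).
Local Open Scope ring_scope.

Definition dot (u v : 'rV[R]_n) : R := \sum_(j < n) u 0 j * v 0 j.

Definition cartan (u a : 'rV[R]_n) : R := 2 * dot u a / dot a a.

Definition refl (a u : 'rV[R]_n) : 'rV[R]_n := u - cartan u a *: a.

Record root_system := RootSystem {
  roots :> {fset 'rV[R]_n};
  roots_span : (<<enum_fset roots>> = fullv)%VS;
  roots_neq0 : 0 \notin roots;
  roots_reduced : forall a c, a \in roots -> c *: a \in roots ->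
    c = 1 \/ c = -1;
  roots_refl : forall a b, a \in roots -> b \in roots -> refl a b \in roots;
  roots_int : forall a b, a \in roots -> b \in roots ->
    exists z : int, cartan b a = z%:~R
}.

Variable Phi : root_system.

Definition irreducible_root_system : Prop :=
  forall A : {set Phi},
    (forall a b, a \in A -> b \notin A -> dot (val a) (val b) = 0) ->
    A = set0 \/ A = setT.

Record base := Base {
  simple_root :> 'I_n -> Phi;
  base_basis : basis_of fullv [tuple val (simple_root k) | k < n];
  base_sign : forall b : Phi, exists c : 'I_n -> nat,
    val b = \sum_(k < n) val (simple_root k) *+ c k \/
    val b = - \sum_(k < n) val (simple_root k) *+ c k
}.

Lemma dotDl u v w : dot (u + v) w = dot u w + dot v w.
Proof.
by rewrite /dot -big_split; apply: eq_bigr => j _; rewrite mxE mulrDl.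
Qed.

Lemma dotZl c u w : dot (c *: u) w = c * dot u w.
Proof.
by rewrite /dot mulr_sumr; apply: eq_bigr => j _; rewrite mxE mulrA.
Qed.

Lemma dot_eq0 u : (dot u u == 0) = (u == 0).
Proof.
apply/idP/eqP=> [|->]; last first.
  by rewrite /dot big1 // => j _; rewrite mxE mul0r.
rewrite /dot psumr_eq0 => [/allP uP|j _]; last by rewrite -expr2 sqr_ge0.
apply/rowP=> j; have := uP j (mem_index_enum _).
by rewrite mxE /= mulf_eq0 orbb => /eqP.
Qed.

Lemma reflK a : a != 0 -> involutive (refl a).
Proof.
rewrite -dot_eq0 => a0 u.
have E : cartan (refl a u) a = - cartan u a.
  rewrite {1}/cartan /refl -scaleNr dotDl dotZl {1}/cartan mulNr.
  rewrite divfK // /cartan -[in RHS]mulNr -[in RHS]mulrN.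
  by congr (_ * _ * _); rewrite mulr_natl mulr2n opprD addrA subrr sub0r.
by rewrite {1}/refl E scaleNr opprK /refl subrK.
Qed.

Definition root_refl_fun (a b : Phi) : Phi :=
  [` roots_refl (valP a) (valP b)]%fset.

Lemma root_refl_inj a : injective (root_refl_fun a).
Proof.
move=> b c /(congr1 val) /= eq_bc; apply/val_inj.
have a0 : val a != 0 by apply: contraNneq (roots_neq0 Phi) => <-; exact: valP.
exact: inv_inj (reflK a0) _ _ eq_bc.
Qed.

(* As the roots span the space, the Weyl group is identified with the group   *)
(* of permutations of Phi it induces. Products in {perm Phi} compose from     *)
(* left to right; w |-> w^-1 fixes every reflection and turns this product    *)
(* into the usual composition of linear maps, so the group with its simple    *)
(* reflections and its reflections is unaffected by this convention.          *)
Definition root_refl (a : Phi) : {perm Phi} := perm (@root_refl_inj a).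

Definition reflections : {set {perm Phi}} := [set root_refl a | a : Phi].

Definition weyl_group : {group {perm Phi}} := <<reflections>>%G.

End RootSystems.

Section Orders.
Variables (R : realFieldType) (n : nat) (Phi : root_system R n).
Variable Delta : base Phi.
Local Open Scope group_scope.
Implicit Types u v w t x : {perm Phi}.

Definition simple_refl (k : 'I_n) : {perm Phi} := root_refl (Delta k).

Definition has_word w (l : nat) : bool :=
  [exists c : l.-tuple 'I_n, w == \prod_(k <- c) simple_refl k].

(* Every element of the Weyl group has a word with fewer than #|{perm Phi}|   *)
(* letters, so the bounded search returns the Coxeter length.                 *)
Definition length w : nat := find (has_word w) (iota 0 #|{perm Phi}|).

Definition weak_edge u v x : bool :=
  [&& [exists k, x == simple_refl k], v == x * u & length v == (length u).+1].

Definition strong_edge u v t : bool :=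
  [&& t \in reflections Phi, v == u * t & length v == (length u).+1].

Definition weak_le : rel {perm Phi} :=
  connect (fun u v => [exists x, weak_edge u v x]).

Definition strong_le : rel {perm Phi} :=
  connect (fun u v => [exists t, strong_edge u v t]).

Definition strong_lt u v : bool := (u != v) && strong_le u v.

Definition min_coset_reps (J : {set 'I_n}) : {set {perm Phi}} :=
  [set w in weyl_group Phi | [forall k in J, strong_lt w (w * simple_refl k)]].

Definition min_coset_reps1 (i : 'I_n) : {set {perm Phi}} :=
  min_coset_reps (~: [set i]).

End Orders.

Section Posets.

Definition order_iso (X Y : finType) (A : {set X}) (leA : rel X)
    (B : {set Y}) (leB : rel Y) (f : X -> Y) : Prop :=
  [/\ {in A &, injective f}, f @: A = B &
      {in A &, forall x y, leB (f x) (f y) = leA x y}].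

Definition is_distributive_lattice (X : finType) (P : {set X}) (le : rel X) :
    Prop :=
  exists (d : Order.disp_t) (L : finDistrLatticeType d) (f : L -> X),
    order_iso [set: L] <=%O P le f.

Definition lower_ideals (d : Order.disp_t) (Q : finPOrderType d) :
    {set {set Q}} :=
  [set A : {set Q} | [forall q in A, forall r, (r <= q)%O ==> (r \in A)]].

Definition maximal_in (d : Order.disp_t) (Q : finPOrderType d) (A : {set Q})
    (q : Q) : bool :=
  (q \in A) && [forall r in A, ~~ (q < r)%O].

(* The edge labeling is given by its graph: label u v s says that u is        *)
(* covered by v along an edge labeled s.                                      *)
Definition distributively_labeled_lattice (X : finType) (S : Type)
    (P : {set X}) (le : rel X) (label : X -> X -> S -> Prop) : Prop :=
  exists (d : Order.disp_t) (Q : finPOrderType d) (f : {set Q} -> X)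
         (p : Q -> S),
    order_iso (lower_ideals Q) (fun A B => A \subset B) P le f /\
    forall (A : {set Q}) (q : Q), A \in lower_ideals Q -> maximal_in A q ->
      label (f (A :\ q)) (f A) (p q).

End Posets.

(* Main.v *)
(* The covers of W^i under the weak order are the products s_k w, and a       *)
(* covering square of a distributive lattice carries commuting simple         *)
(* reflections, so its opposite sides have equal labels, both for the label   *)
(* s_k and for w^-1 s_k w. Birkhoff's theorem then yields the labelings by    *)
(* join-irreducible elements.                                                 *)
(*                                                                            *)
(* For the comparison of the orders, W^i is identified with the orbit of the  *)
(* fundamental weight omega_i. It suffices that s_g lambda is above lambda in *)
(* the weak order of the orbit whenever g is a positive root with             *)
(* (lambda, g) > 0. This follows by induction on the height of g, writing     *)
(* s_g = s_k s_g' s_k: the steps s_k at both ends either go up or cancel,     *)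
(* because labels of a distributive lattice are carried along parallel covers.*)

From HB Require Import structures.
Require Import Defs.
From mathcomp Require Import all_boot all_order all_algebra all_fingroup.
From mathcomp Require Import finmap.
From mathcomp Require Import ring.

Set Implicit Arguments.
Unset Strict Implicit.
Unset Printing Implicit Defensive.

Import Order.TTheory GRing.Theory Num.Theory.

(** * Labeled distributive lattices *)

(** Everything rests on parallel covers having equal labels. In a square of [W^i] with bottom [w],
    the two ways up give [s_l s_k = s_m s_j] with [k], [j] distinct and no cancellation; this forces
    [l = j] and [m = k], so the letters commute ([square_commute]). Opposite sides then agree both
    for the left label [s_k] and for the right label [w^-1 s_k w]. In a distributive lattice this
    propagates from a cover to all its translates by joins ([lab_transport]), and removing a maximal
    [q] from an ideal is such a translate of the cover below the join-irreducible [q]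
    ([birkhoff_labeled]).

    A weak cover is a strong cover, since [s_k w = w (w^-1 s_k w)]. Conversely, a strong chain
    between elements of [W^i] may leave [W^i], so it is followed through weights, that is, through
    the orbit of the fundamental weight; these separate [W^i] ([weight_inj]). Each strong cover
    fixes the weight or reflects it in a positive root pairing positively with it, and
    [weak_le_reflection] realizes the latter by going up in the weak order. Its induction conjugates
    by a simple reflection; opposite moves by the same letter cancel because labels are transported
    ([weak_le_cancel_up], [weak_le_cancel_down]). *)

Section Covers.
Variables (d : Order.disp_t) (L : finDistrLatticeType d).
Implicit Types a b c x y z : L.
Local Open Scope order_scope.

Definition covers x y : bool :=
  (x < y) && [forall z, (x < z) && (z <= y) ==> (z == y)].

Lemma coversP x y :
  reflect (x < y /\ forall z, x < z -> z <= y -> z = y) (covers x y).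
Proof.
apply: (iffP andP) => [[xy /forallP h]|[xy h]]; split=> //.
  by move=> z xz zy; apply/eqP; apply: (implyP (h z)); rewrite xz zy.
by apply/forallP => z; apply/implyP => /andP[xz zy]; rewrite (h z).
Qed.

Lemma covers_meet x y a : covers x y -> x <= a -> ~~ (y <= a) -> a `&` y = x.
Proof.
move=> /coversP[xy h] xa nya; apply/eqP; rewrite eq_le lexI xa (ltW xy) !andbT.
have: x <= a `&` y by rewrite lexI xa ltW.
rewrite [x <= _]le_eqVlt => /predU1P[<- // |lt_x].
by have := h _ lt_x (leIr _ _) => e; move: nya; rewrite -[y]e leIl.
Qed.

(** By distributivity any [z] above [a] and below the join is the join of [a] with the meet of [z]
    and [y]; that meet lies strictly above [x], hence is [y]. *)
Lemma covers_join x y a :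
  covers x y -> x <= a -> ~~ (y <= a) -> covers a (a `|` y).
Proof.
move=> cxy xa nya; have e := covers_meet cxy xa nya.
apply/coversP; split=> [|z az zay]; first by rewrite lt_def leUl andbT;
  apply: contraNneq nya => <-; exact: leUr.
have zE : z = a `|` (z `&` y).
  by rewrite -[z in LHS](meet_l zay) meetUr meetC (meet_l (ltW az)).
have: ~~ ((z `&` y) <= x).
  apply/negP => zyx; have : z <= a by rewrite zE leUx lexx (le_trans zyx).
  by rewrite (lt_geF az).
move: (cxy) => /coversP[xy h] nzy.
have xzy : x <= z `&` y by rewrite lexI (le_trans xa (ltW az)) ltW.
suff e2 : z `&` y = y by rewrite zE e2.
apply: h; last exact: leIr.
by rewrite lt_leAnge xzy nzy.
Qed.

Lemma meet_covers b c : covers c (b `|` c) -> covers (b `&` c) b.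
Proof.
move=> /coversP[lt_c h]; apply/coversP; split=> [|z lt_z zb].
  rewrite lt_def leIl andbT; apply: contraTneq lt_c => bE.
  by rewrite join_r ?ltxx // bE leIr.
have : c <= z `|` c by rewrite leUr.
rewrite [c <= _]le_eqVlt => /predU1P[cE|lt_cz].
  by have := lt_geF lt_z; rewrite lexI zb {1}cE leUl.
have := h _ lt_cz; rewrite leUx (le_trans zb (leUl _ _)) leUr => /(_ isT) e.
have : b = (z `|` c) `&` b by rewrite e meetC (meet_l (leUl _ _)).
rewrite meetUl (meet_l zb) [c `&` b]meetC join_l ?(ltW lt_z) //.
Qed.

Lemma covers_between x a :
  x < a -> exists2 y, x <= y & covers y a.
Proof.
move=> xa; have [y /andP[xy ya] ymin] :=
  arg_maxnP (fun y => #|[set z | z <= y]|) (i0 := x)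
    (P := fun y => (x <= y) && (y < a)) (introT andP (conj (lexx x) xa)).
exists y => //; apply/coversP; split=> // z yz; rewrite le_eqVlt.
move=> /orP[/eqP // |za]; have := ymin z.
rewrite za (ltW (le_lt_trans xy yz)) => /(_ isT); rewrite /= leqNgt => /negP[].
apply/proper_card/properP; split.
  by apply/subsetP=> t; rewrite !inE => /le_trans -> //; exact: ltW.
by exists z; rewrite !inE ?lexx // (lt_geF yz).
Qed.

Variables (S : Type) (lab : L -> L -> S).
Hypothesis lab_diamond : forall x y y', covers x y -> covers x y' -> y != y' ->
  covers y (y `|` y') -> covers y' (y `|` y') -> lab x y = lab y' (y `|` y').

(** Induction on the size of the principal ideal of [a]: for [a'] above [x] and covered by [a], the
    covers of [a'] by its join with [y] and of [a] by its join with [y] are opposite sides of a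
    square. *)
Lemma lab_transport x y a : covers x y -> x <= a -> ~~ (y <= a) ->
  lab a (a `|` y) = lab x y.
Proof.
move=> cxy; have [N] := ubnP #|[set z | z <= a]|.
elim: N a => // N IH a /ltnSE le_aN xa nya.
move: (xa); rewrite le_eqVlt => /orP[/eqP xE|lt_xa].
  by rewrite -xE join_r //; case/coversP: cxy => /ltW.
have [a' xa' ca'a] := covers_between lt_xa.
have lt_a'a : a' < a by case/coversP: ca'a.
have nya' : ~~ (y <= a') by apply: contraNN nya => /le_trans; apply; exact: ltW.
rewrite -(IH a') //; last first.
  apply: leq_trans le_aN; apply/proper_card/properP; split.
    by apply/subsetP=> t; rewrite !inE => /le_trans -> //; exact: ltW.
  by exists a; rewrite !inE ?lexx // (lt_geF lt_a'a).
have jE : a' `|` y `|` a = a `|` y.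
  by rewrite joinAC (join_r (ltW lt_a'a)).
rewrite -jE; symmetry; apply: lab_diamond; rewrite ?jE //.
- exact: covers_join cxy xa' nya'.
- by apply: contraNneq nya => <-; rewrite leUr.
- rewrite -jE; apply: covers_join ca'a _ _; first exact: leUl.
  apply/negP => aj; have : a <= a' `|` y by [].
  move: (covers_join cxy xa' nya') => /coversP[_ h].
  by move=> /(h _ lt_a'a) aE; move: nya; rewrite aE leUr.
- exact: covers_join cxy xa nya.
Qed.

End Covers.

(** * Join-irreducible elements and the labeled Birkhoff representation *)

Section JoinIrreducible.
Variables (d : Order.disp_t) (L : finDistrLatticeType d).
Implicit Types a b c x y z : L.
Local Open Scope order_scope.

Definition largest_below x y : bool :=
  (y < x) && [forall z, (z < x) ==> (z <= y)].

(** In a finite lattice this is the usual notion: existence of the element below excludes the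
    bottom, and its being largest makes it the only lower cover. *)
Definition join_irreducible x : bool := [exists y, largest_below x y].

Definition jirr : Type := {x : L | join_irreducible x}.

HB.instance Definition _ := SubFinite.on jirr.
HB.instance Definition _ := [SubChoice_isSubPOrder of jirr by <: with d].

Lemma le_jirr (q r : jirr) : (q <= r) = (val q <= val r).
Proof. by []. Qed.

Definition jpred (q : jirr) : L := xchoose (existsP (valP q)).

Lemma jpredP (q : jirr) :
  jpred q < val q /\ forall z, z < val q -> z <= jpred q.
Proof.
have /andP[h1 /forallP h2] := xchooseP (existsP (valP q)).
by split=> // z; apply: implyP (h2 z).
Qed.

Lemma covers_jpred q : covers (jpred q) (val q).
Proof.
have [lt_q h] := jpredP q; apply/coversP; split=> // z lt_z.
by rewrite le_eqVlt => /predU1P[//|/h]; rewrite (lt_geF lt_z).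
Qed.

(** A minimal [z] below [x] but not below [y] is join-irreducible: by minimality its meet with [y]
    is the largest element strictly below it. *)
Lemma jirr_separation x y :
  ~~ (x <= y) -> exists2 q : jirr, val q <= x & ~~ (val q <= y).
Proof.
move=> nxy; have [z /andP[zx nzy] zmin] :=
  arg_minnP (fun z => #|[set t | t <= z]|) (i0 := x)
    (P := fun z => (z <= x) && ~~ (z <= y)) (introT andP (conj (lexx x) nxy)).
have zP : join_irreducible z.
  apply/existsP; exists (z `&` y); apply/andP; split.
    by rewrite lt_def leIl andbT; apply: contraNneq nzy => ->; rewrite leIr.
  apply/forallP => t; apply/implyP => tz; rewrite lexI (ltW tz) /=.
  apply: contraTT tz => nty; rewrite lt_leAnge negb_and.
  apply/orP; case tz: (t <= z); last by left.
  right; rewrite negbK; apply: contraT => nzt.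
  have := zmin t; rewrite (le_trans tz zx) nty => /(_ isT).
  rewrite leqNgt => /negP[]; apply/proper_card/properP; split.
    by apply/subsetP=> s; rewrite !inE => /le_trans ->.
  by exists z; rewrite !inE ?lexx.
by exists (Sub z zP); rewrite SubK.
Qed.

(** If [q] were below neither, its meets with [x] and [y] would both lie below [jpred q], and by
    distributivity so would [q]. *)
Lemma jirr_prime (q : jirr) x y :
  (val q <= x `|` y) = (val q <= x) || (val q <= y).
Proof.
apply/idP/orP => [qxy|[/le_trans->//|/le_trans->//]]; rewrite ?leUl ?leUr //.
have [nqx|] := boolP (val q <= x); first by left.
right; apply: contraT => nqy; have [lt_q h] := jpredP q.
have nI z : ~~ (val q <= z) -> val q `&` z <= jpred q.
  move=> nqz; apply: h; rewrite lt_def leIl andbT.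
  by apply: contraNneq nqz => ->; exact: leIr.
by rewrite -(lt_geF lt_q) -(meet_l qxy) meetUr leUx !nI.
Qed.

Lemma finite_bottom (x0 : L) : exists b, forall x, b <= x.
Proof.
exists (\big[Order.meet/x0]_(y <- enum L) y) => x.
have : x \in enum L by rewrite mem_enum.
elim: (enum L) => // y s IH; rewrite inE big_cons => /predU1P[->|/IH].
  exact: leIl.
by apply: le_trans; exact: leIr.
Qed.

Variable bot : L.
Hypothesis bot_le : forall x, bot <= x.
Implicit Types (q r : jirr) (A B : {set jirr}).

Definition jirr_join A : L := \big[Order.join/bot]_(q <- enum A) val q.

Lemma le_jirr_join q A : q \in A -> val q <= jirr_join A.
Proof.
rewrite /jirr_join -mem_enum; elim: (enum A) => // r s IH.
rewrite inE big_cons => /predU1P[->|/IH]; first exact: leUl.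
by move/le_trans; apply; exact: leUr.
Qed.

Lemma jirr_join_le A x : (forall q, q \in A -> val q <= x) -> jirr_join A <= x.
Proof.
move=> h; have {h} : {in enum A, forall q, val q <= x}.
  by move=> q; rewrite mem_enum; exact: h.
rewrite /jirr_join; elim: (enum A) => [|r s IH] h; first by rewrite big_nil.
rewrite big_cons leUx h ?mem_head // IH // => q qs.
by apply: h; rewrite inE qs orbT.
Qed.

Lemma jirr_le_join q A :
  val q <= jirr_join A -> exists2 r, r \in A & val q <= val r.
Proof.
rewrite /jirr_join => qA.
suff [r rA qr] : exists2 r, r \in enum A & val q <= val r.
  by exists r; rewrite // -mem_enum.
elim: (enum A) qA => [|r s IH].
  rewrite big_nil => q_bot; have [lt_q _] := jpredP q.
  by have := lt_geF lt_q; rewrite (le_trans q_bot).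
rewrite big_cons jirr_prime => /orP[qr|/IH[t ts qt]].
  by exists r; rewrite ?mem_head.
by exists t; rewrite // inE ts orbT.
Qed.

Lemma lower_idealsP A : reflect (forall q r, q \in A -> r <= q -> r \in A)
  (A \in lower_ideals jirr).
Proof.
rewrite inE; apply: (iffP forall_inP) =>
    [h q r /h/forallP/(_ r)/implyP//|h q qA].
by apply/forallP => r; apply/implyP; exact: h.
Qed.

Lemma mem_jirr_join q A :
  A \in lower_ideals jirr -> (val q <= jirr_join A) = (q \in A).
Proof.
move=> /lower_idealsP idA; apply/idP/idP; last exact: le_jirr_join.
by move=> /jirr_le_join[r rA]; rewrite -le_jirr; exact: idA.
Qed.

Lemma jirr_join_mono A B : A \in lower_ideals jirr ->
  B \in lower_ideals jirr -> (jirr_join A <= jirr_join B) = (A \subset B).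
Proof.
move=> idA idB; apply/idP/subsetP => [AB q|AB].
  by rewrite -!mem_jirr_join // => /le_trans; apply.
by apply: jirr_join_le => q /AB; exact: le_jirr_join.
Qed.

Lemma jirr_join_below x : jirr_join [set q | val q <= x] = x.
Proof.
apply/eqP; rewrite eq_le; apply/andP; split.
  by apply: jirr_join_le => q; rewrite inE.
apply: contraT => /jirr_separation[q qx].
by rewrite le_jirr_join // inE.
Qed.

Lemma below_ideal x : [set q : jirr | val q <= x] \in lower_ideals jirr.
Proof.
apply/lower_idealsP => q r; rewrite !inE le_jirr => qx rq.
exact: le_trans rq qx.
Qed.

Lemma birkhoff_labeled (X : finType) (S : Type) (P : {set X}) (le : rel X)
    (f : L -> X) (lab : L -> L -> S) (label : X -> X -> S -> Prop) :
  order_iso [set: L] <=%O P le f ->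
  (forall x y, covers x y -> label (f x) (f y) (lab x y)) ->
  (forall x y y', covers x y -> covers x y' -> y != y' ->
    covers y (y `|` y') -> covers y' (y `|` y') ->
    lab x y = lab y' (y `|` y')) ->
  distributively_labeled_lattice P le label.
Proof.
move=> [f_inj fP f_mono] labP lab_diamond.
exists d, jirr, (f \o jirr_join), (fun q => lab (jpred q) (val q)).
split=> [|A q idA /andP[qA /forall_inP qmax]].
  split=> [A B idA idB /= /f_inj|| A B idA idB /=].
  - rewrite !inE => /(_ isT isT) eAB; apply/eqP.
    by rewrite eqEsubset -!jirr_join_mono // eAB lexx.
  - apply/setP => y; rewrite -fP; apply/imsetP/imsetP => [[A idA ->]|[x _ ->]].
      by exists (jirr_join A).
    exists [set q | val q <= x]; first exact: below_ideal.
    by rewrite /= jirr_join_below.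
  - by rewrite f_mono ?inE // jirr_join_mono.
have idD : A :\ q \in lower_ideals jirr.
  apply/lower_idealsP => r s; rewrite !inE => /andP[rq rA] sr.
  rewrite (lower_idealsP _ idA r) // andbT; apply: contraNneq (qmax r rA) => sq.
  by rewrite lt_def rq -sq.
have nq : ~~ (val q <= jirr_join (A :\ q)).
  by rewrite mem_jirr_join // !inE eqxx.
(* With [nq] and [jE], this exhibits the cover from [A :\ q] to [A] as the translate of the cover
   from [jpred q] to [q]. *)
have le_q : jpred q <= jirr_join (A :\ q).
  rewrite -[jpred q]jirr_join_below jirr_join_mono ?below_ideal //.
  apply/subsetP => r; rewrite !inE => rq; have [lt_q _] := jpredP q.
  have lt_rq := le_lt_trans rq lt_q.
  rewrite (lower_idealsP _ idA q) ?le_jirr ?(ltW lt_rq) // andbT.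
  by apply: contraTneq lt_rq => ->; rewrite ltxx.
have jE : jirr_join (A :\ q) `|` val q = jirr_join A.
  apply/eqP; rewrite eq_le leUx le_jirr_join // jirr_join_mono // subD1set /=.
  apply: jirr_join_le => r rA; have [->|rq] := eqVneq r q; first exact: leUr.
  by apply: le_trans (leUl _ _); apply: le_jirr_join; rewrite !inE rq.
have cq := covers_jpred q.
rewrite /= -jE -(lab_transport lab_diamond cq le_q nq).
by apply: labP; exact: covers_join cq le_q nq.
Qed.

End JoinIrreducible.

(** * Roots and positivity *)

Section Roots.
Variables (R : realFieldType) (n : nat) (Phi : root_system R n).
Local Open Scope ring_scope.
Implicit Types (a b c : Phi) (u v : 'rV[R]_n) (w : {perm Phi}).

Lemma dotC u v : dot u v = dot v u.
Proof. by apply: eq_bigr => j _; rewrite mulrC. Qed.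

Lemma dotE u v : u *m v^T = (dot u v)%:M.
Proof.
apply/matrixP=> x y; rewrite !ord1 !mxE eqxx mulr1n.
by apply: eq_bigr => j _; rewrite mxE.
Qed.

Lemma dot_gt0 u : (0 < dot u u) = (u != 0).
Proof.
rewrite lt_def dot_eq0 andb_idr // => _.
by apply: sumr_ge0 => j _; rewrite -expr2 sqr_ge0.
Qed.

Lemma root_neq0 a : val a != 0.
Proof. by apply: contraNneq (roots_neq0 Phi) => <-; exact: valP. Qed.

Lemma root_dot_gt0 a : 0 < dot (val a) (val a).
Proof. by rewrite dot_gt0 root_neq0. Qed.

Lemma cartan_id a : cartan (val a) (val a) = 2.
Proof. by rewrite /cartan mulfK // lt0r_neq0 ?root_dot_gt0. Qed.

Lemma cartan_gt0 u a : (0 < cartan u (val a)) = (0 < dot u (val a)).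
Proof.
by rewrite /cartan pmulr_lgt0 ?invr_gt0 ?root_dot_gt0 // pmulr_rgt0 ?ltr0n.
Qed.

Lemma val_root_refl a b :
  val (root_refl a b) = val b - cartan (val b) (val a) *: val a.
Proof. by rewrite permE. Qed.

Lemma root_reflK a : involutive (root_refl a).
Proof.
by move=> b; apply: val_inj; rewrite !permE /=; apply: reflK; exact: root_neq0.
Qed.

Lemma root_refl_invol a : (root_refl a * root_refl a = 1)%g.
Proof. by apply/permP => b; rewrite permM perm1 root_reflK. Qed.

Lemma root_reflV a : ((root_refl a)^-1 = root_refl a)%g.
Proof. by apply/eqP; rewrite eq_invg_mul root_refl_invol. Qed.

Definition root_opp a : Phi := root_refl a a.

Lemma val_root_opp a : val (root_opp a) = - val a.
Proof.
by rewrite val_root_refl cartan_id scaler_nat mulr2n opprD addrA subrr sub0r.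
Qed.

Lemma root_oppK : involutive root_opp.
Proof. by move=> a; apply: val_inj; rewrite !val_root_opp opprK. Qed.

Lemma dotNr u v : dot u (- v) = - dot u v.
Proof. by rewrite -scaleN1r dotC dotZl dotC mulN1r. Qed.

Lemma root_refl_opp a : root_refl (root_opp a) = root_refl a.
Proof.
apply/permP => b; apply: val_inj.
rewrite [LHS]val_root_refl [RHS]val_root_refl val_root_opp.
congr (_ - _); rewrite /cartan !dotNr [dot (- _) _]dotC dotNr opprK.
by rewrite scalerN mulrN mulNr scaleNr opprK.
Qed.

(** Recovers the linear isometry behind a permutation of the roots. Matrices act on row vectors from
    the right, matching the left-to-right product of permutations. *)
Lemma weyl_linear w : w \in weyl_group Phi -> exists M : 'M[R]_n,
  (forall b, val (w b) = val b *m M) /\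
  forall u v, dot (u *m M) (v *m M) = dot u v.
Proof.
case/gen_prodgP => m [c cP ->].
elim/big_ind: _ => [|w1 w2 [M1 [h1 i1]] [M2 [h2 i2]]|j _].
- by exists 1%:M; split=> [b|u v]; rewrite ?perm1 ?mulmx1.
- exists (M1 *m M2); split=> [b|u v]; first by rewrite permM h2 h1 mulmxA.
  by rewrite !mulmxA i2 i1.
have /imsetP[a _ ->] := cP j; set k := 2 / dot (val a) (val a).
exists (1%:M - k *: ((val a)^T *m val a)).
have E u : u *m (1%:M - k *: ((val a)^T *m val a)) = refl (val a) u.
  rewrite mulmxBr mulmx1 -scalemxAr mulmxA dotE mul_scalar_mx scalerA.
  by rewrite /refl /cartan /k mulrAC.
split=> [b|u v]; first by rewrite E permE.
rewrite !E /refl -!scaleNr !dotDl !dotZl ![dot _ (_ + _ *: _)]dotC.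
rewrite !dotDl !dotZl [dot v u]dotC [dot v (val a)]dotC [dot (val a) u]dotC.
rewrite [dot (val a) v]dotC /cartan.
have := lt0r_neq0 (root_dot_gt0 a); move: (dot (val a) (val a)) => z z0.
move: (dot u v) (dot u (val a)) (dot v (val a)) => p q r.
by field.
Qed.

Lemma weyl_dot w a b : w \in weyl_group Phi ->
  dot (val (w a)) (val (w b)) = dot (val a) (val b).
Proof. by case/weyl_linear => M [h iso]; rewrite !h iso. Qed.

Lemma weyl_refl w a b : w \in weyl_group Phi ->
  w (root_refl a b) = root_refl (w a) (w b).
Proof.
move=> wW; apply: val_inj; rewrite val_root_refl /cartan !weyl_dot //.
by case/weyl_linear: wW => M [h _]; rewrite !h val_root_refl mulmxBl scalemxAl.
Qed.

Lemma weyl_conj w a : w \in weyl_group Phi ->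
  (root_refl a ^ w = root_refl (w a))%g.
Proof.
by move=> wW; apply/permP => b; rewrite conjgE !permM weyl_refl // permKV.
Qed.

Lemma root_refl_weyl a : root_refl a \in weyl_group Phi.
Proof. by apply: mem_gen; apply: imset_f. Qed.

Lemma weyl_opp w a : w \in weyl_group Phi -> w (root_opp a) = root_opp (w a).
Proof. exact: weyl_refl. Qed.

(** * Coefficients in the base and positive roots *)

Variable Delta : base Phi.

Local Notation s := (simple_refl Delta).

Definition base_tuple := [tuple val (Delta k) | k < n].

Definition cf (k : 'I_n) : 'rV[R]_n -> R := coord base_tuple k.

Lemma cfD k u v : cf k (u + v) = cf k u + cf k v. Proof. exact: raddfD. Qed.
Lemma cfN k u : cf k (- u) = - cf k u. Proof. exact: raddfN. Qed.
Lemma cfZ k x u : cf k (x *: u) = x * cf k u.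
Proof. by rewrite /cf linearZ. Qed.

Lemma nth_base_tuple (k : 'I_n) : base_tuple`_k = val (Delta k).
Proof. by rewrite -tnth_nth tnth_mktuple. Qed.

Lemma cf_simple k j : cf k (val (Delta j)) = (k == j)%:R.
Proof.
rewrite -nth_base_tuple /cf coord_free 1?eq_sym //.
exact: basis_free (base_basis Delta).
Qed.

Lemma cf_expand v : v = \sum_k cf k v *: val (Delta k).
Proof.
rewrite [LHS](coord_basis (base_basis Delta) (memvf v)).
by apply: eq_bigr => k _; rewrite nth_base_tuple.
Qed.

Lemma cf_sum k (x : 'I_n -> R) (v : 'I_n -> 'rV[R]_n) :
  cf k (\sum_j x j *: v j) = \sum_j x j * cf k (v j).
Proof. by rewrite /cf linear_sum; apply: eq_bigr => j _; rewrite linearZ. Qed.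

Definition pos b : bool := [forall k, 0 <= cf k (val b)].

Lemma pos_or_neg b : pos b \/ forall k, cf k (val b) <= 0.
Proof.
have cE (c : 'I_n -> nat) k :
    cf k (\sum_(j < n) val (Delta j) *+ c j) = (c k)%:R.
  rewrite (eq_bigr (fun j => (c j)%:R *: val (Delta j))) => [|j _]; last first.
    by rewrite scaler_nat.
  rewrite cf_sum (bigD1 k) //= cf_simple eqxx mulr1 big1 ?addr0 // => j jk.
  by rewrite cf_simple eq_sym (negbTE jk) mulr0.
have [c [bE|bE]] := base_sign Delta b; [left|right].
  by apply/forallP => k; rewrite bE cE ler0n.
by move=> k; rewrite bE cfN cE oppr_le0 ler0n.
Qed.

Lemma pos_opp b : pos (root_opp b) = ~~ pos b.
Proof.
have [p|m] := pos_or_neg b; last first.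
  have -> : pos (root_opp b).
    by apply/forallP => k; rewrite val_root_opp cfN oppr_ge0.
  symmetry; apply: contraNN (root_neq0 b) => /forallP p.
  rewrite (cf_expand (val b)) big1 // => k _.
  by have /eqP -> : cf k (val b) == 0; rewrite ?scale0r // eq_le m p.
rewrite p; apply: contraNF (root_neq0 b) => /forallP m.
rewrite (cf_expand (val b)) big1 // => k _.
have /eqP -> : cf k (val b) == 0; rewrite ?scale0r // eq_le (forallP p k) andbT.
by rewrite -oppr_ge0 -cfN -val_root_opp.
Qed.

Lemma cf_pos b k : pos b -> 0 <= cf k (val b).
Proof. by move/forallP. Qed.

Lemma cf_neg b k : ~~ pos b -> cf k (val b) <= 0.
Proof. by rewrite -pos_opp => /(cf_pos k);
  rewrite val_root_opp cfN oppr_ge0. Qed.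

Lemma pos_cf_gt0 b k : 0 < cf k (val b) -> pos b.
Proof. by move=> h; apply: contraT => /(cf_neg k); rewrite leNgt h. Qed.

Lemma cf_lt0_neg b k : cf k (val b) < 0 -> ~~ pos b.
Proof. by move=> h; apply/negP => /(cf_pos k); rewrite leNgt h. Qed.

Lemma pos_simple k : pos (Delta k).
Proof. by apply: (@pos_cf_gt0 _ k); rewrite cf_simple eqxx ltr01. Qed.

Lemma cf_simple_refl k j b :
  cf j (val (s k b)) =
  cf j (val b) - cartan (val b) (val (Delta k)) * (j == k)%:R.
Proof. by rewrite val_root_refl cfD cfN cfZ cf_simple. Qed.

(** As the root system is reduced, [b] has a nonzero coefficient away from [k]; [s k] leaves it
    unchanged, and one positive coefficient decides the sign. *)
Lemma pos_simple_refl k b : pos b -> b != Delta k -> pos (s k b).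
Proof.
move=> pb nb; have [j jk cj] : exists2 j, j != k & cf j (val b) != 0.
  apply/exists_inP; apply: contraNT nb => /exists_inPn h.
  have bE : val b = cf k (val b) *: val (Delta k).
    rewrite {1}(cf_expand (val b)) (bigD1 k) //= big1 ?addr0 // => j jk.
    by have /eqP -> : cf j (val b) == 0; rewrite ?scale0r //; apply/negPn/h.
  have [] := @roots_reduced _ _ Phi (val (Delta k)) (cf k (val b)).
  - exact: valP.
  - by rewrite -bE; exact: valP.
  - by move=> c1; apply/eqP/val_inj; rewrite bE c1 scale1r.
  - by move=> c1; have := cf_pos k pb; rewrite c1 oppr_ge0 ler10.
apply: (@pos_cf_gt0 _ j); rewrite cf_simple_refl (negbTE jk) mulr0 subr0.
by rewrite lt_def cj cf_pos.
Qed.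

Lemma pos_simple_reflE k b : b != Delta k -> b != root_opp (Delta k) ->
  pos (s k b) = pos b.
Proof.
move=> nb nb'; apply/idP/idP => [pb|]; last by move/pos_simple_refl; apply.
rewrite -[b](root_reflK (Delta k)) pos_simple_refl //.
apply: contraNneq nb' => sb; apply/eqP.
by rewrite -[b](root_reflK (Delta k)); congr (root_refl _ _).
Qed.

(** Otherwise expanding one argument of [dot b b] in the base would make it nonpositive. *)
Lemma pos_dot_gt0 b : pos b -> exists k, 0 < dot (val b) (val (Delta k)).
Proof.
move=> pb; apply/existsP; apply: contraT => /existsPn h.
have := root_dot_gt0 b; rewrite {1}(cf_expand (val b)) ltNge => /negP[].
rewrite (big_morph (fun x => dot x (val b)) (fun x y => dotDl x y _)
  (id1 := 0)); last first.
  by rewrite -(scale0r 0) dotZl mul0r.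
apply: sumr_le0 => k _; rewrite dotZl mulr_ge0_le0 ?cf_pos // dotC leNgt.
exact: h.
Qed.

Definition height b : R := \sum_k cf k (val b).

Lemma height_simple_refl k b : 0 < dot (val b) (val (Delta k)) ->
  height (s k b) < height b.
Proof.
move=> h; rewrite /height (eq_bigr _ (fun j _ => cf_simple_refl k j b)).
rewrite sumrB gtrBl // (bigD1 k) //= eqxx mulr1 big1 ?addr0 ?cartan_gt0 //.
by move=> j /negbTE ->; rewrite mulr0.
Qed.

(** Induction on height. Heights lie in [R], so the measure is the number of roots of smaller
    height. *)
Lemma pos_root_ind (P : Phi -> Prop) :
  (forall k, P (Delta k)) ->
  (forall b k, pos b -> pos (s k b) -> 0 < dot (val b) (val (Delta k)) ->
     P (s k b) -> P b) ->
  forall b, pos b -> P b.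
Proof.
move=> Psimple Pstep b; have [N] := ubnP #|[set c | height c < height b]|.
elim: N b => // N IH b /ltnSE leN pb; have [k hk] := pos_dot_gt0 pb.
have [->//|nb] := eqVneq b (Delta k).
have pkb := pos_simple_refl pb nb; apply: (Pstep _ k) => //; apply: IH => //.
have lt_h := height_simple_refl hk.
apply: leq_trans leN; apply/proper_card/properP; split.
  by apply/subsetP => c; rewrite !inE => /lt_trans; apply.
by exists (s k b); rewrite !inE ?ltxx.
Qed.

End Roots.

(** * Length and the exchange property *)

Section Length.
Variables (R : realFieldType) (n : nat) (Phi : root_system R n).
Variable Delta : base Phi.
Local Open Scope group_scope.
Implicit Types (b : Phi) (u v w t x : {perm Phi}) (k j : 'I_n) (c : seq 'I_n).
Local Notation s := (simple_refl Delta).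
Local Notation W := (weyl_group Phi).
Local Notation pos := (pos Delta).
Local Notation length := (length Delta).
Local Notation word c := (\prod_(k <- c) s k).

Lemma simple_refl_weyl k : s k \in W.
Proof. exact: root_refl_weyl. Qed.

Lemma root_refl_gen_simple b : root_refl b \in <<[set s k | k : 'I_n]>>.
Proof.
have simple_gen k : s k \in <<[set s k | k : 'I_n]>>.
  by apply: mem_gen; apply: imset_f.
wlog pb : b / pos b => [hw|].
  have [/hw//|nb] := boolP (pos b).
  by rewrite -root_refl_opp hw // pos_opp.
move: b pb; apply: pos_root_ind => // b k _ _ _ h.
by have := groupJ h (simple_gen k);
  rewrite weyl_conj ?root_refl_weyl // root_reflK.
Qed.

Lemma weyl_word w : w \in W -> exists c, w = word c.
Proof.
have sub : W \subset <<[set s k | k : 'I_n]>>.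
  by rewrite gen_subG; apply/subsetP => _ /imsetP[b _ ->];
    exact: root_refl_gen_simple.
move/(subsetP sub); case/gen_prodgP => m [x xP ->].
elim/big_ind: _ => [|_ _ [c1 ->] [c2 ->]|j _].
- by exists [::]; rewrite big_nil.
- by exists (c1 ++ c2); rewrite big_cat.
by have /imsetP[k _ ->] := xP j; exists [:: k]; rewrite big_seq1.
Qed.

Lemma word_weyl c : word c \in W.
Proof. by apply: group_prod => k _; exact: simple_refl_weyl. Qed.

Lemma has_wordP w l :
  reflect (exists2 c, size c = l & w = word c) (has_word Delta w l).
Proof.
apply: (iffP existsP) => [[c /eqP ->]|[c sc ->]].
  by exists c; rewrite ?size_tuple.
by have sc' : size c == l by [apply/eqP]; exists (Tuple sc').
Qed.

(** A path without repetition from 1 in the Cayley graph visits distinct permutations; this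
    justifies the search bound in [length]. *)
Lemma weyl_short_word w :
  w \in W -> exists2 c, (size c < #|{perm Phi}|)%N & w = word c.
Proof.
pose e : rel {perm Phi} := fun u v => [exists k, v == u * s k].
case/weyl_word => c wE.
have : connect e 1 w.
  suff /(_ 1) : forall u, connect e u (u * word c) by rewrite mul1g wE.
  elim: c {wE} => [|k c IH] u; first by rewrite big_nil mulg1 connect0.
  rewrite big_cons mulgA; apply: connect_trans (IH _); apply: connect1.
  by apply/existsP; exists k.
case/connectP => p0 /shortenP[p ep up _] ->.
have path_word u : path e u p ->
    exists2 c', size c' = size p & last u p = u * word c'.
  elim: p u {ep up} => [|v p IH] u /=.
    by exists [::]; rewrite ?big_nil ?mulg1.
  case/andP => /existsP[k /eqP ->] /IH[c' sc' ->].
  by exists (k :: c'); rewrite /= ?sc' // big_cons mulgA.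
have [c' sc' ->] := path_word 1 ep; exists c'; last by rewrite mul1g.
by rewrite sc' -/(size (1 :: p)) -(card_uniqP up) max_card.
Qed.

Lemma lengthP w : w \in W -> exists2 c, size c = length w & w = word c.
Proof.
case/weyl_short_word => c sc wE; apply/has_wordP.
have hw : has (has_word Delta w) (iota 0 #|{perm Phi}|).
  apply/hasP; exists (size c); first by rewrite mem_iota.
  by apply/has_wordP; exists c.
have := nth_find 0 hw; rewrite nth_iota ?add0n //.
by rewrite -[X in (_ < X)%N](size_iota 0) -has_find.
Qed.

Lemma length_word c : (length (word c) <= size c)%N.
Proof.
rewrite leqNgt; apply/negP => lt_c; have := before_find 0 lt_c.
rewrite nth_iota; last first.
  apply: leq_trans lt_c _; rewrite -[leqRHS](size_iota 0); exact: find_size.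
by move/has_wordP; apply; exists c.
Qed.

Lemma length_mulr w k : w \in W -> (length (w * s k) <= (length w).+1)%N.
Proof.
case/lengthP => c <- {1}->; have := length_word (rcons c k).
by rewrite -cats1 big_cat big_seq1 size_cat addn1.
Qed.

Lemma length_mull w k : w \in W -> (length (s k * w) <= (length w).+1)%N.
Proof.
by case/lengthP => c <- {1}->; have := length_word (k :: c); rewrite big_cons.
Qed.

(** Strong exchange: apply the letters to [b] one by one, from the left. Where the root turns
    negative it was the simple root of that letter, and multiplying by the reflection deletes this
    letter. *)
Lemma word_exchange b c : pos b -> ~~ pos ((word c)^-1 b) ->
  exists2 c', size c = (size c').+1 & word c * root_refl b = word c'.
Proof.
move=> pb; elim: c => [|k c IH]; first by rewrite big_nil invg1 perm1 pb.
rewrite big_cons invMg permM root_reflV => nb.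
have [pc|/IH[c' sc' cE]] := boolP (pos ((word c)^-1 b)); last first.
  by exists (k :: c'); rewrite /= ?sc' // big_cons -mulgA cE.
exists c => //; have /eqP bE : (word c)^-1 b == Delta k.
  by apply: contraNT nb; exact: pos_simple_refl.
rewrite -mulgA [word c * _]conjgCV weyl_conj ?groupV ?word_weyl // bE mulgA.
by rewrite root_refl_invol mul1g.
Qed.

Lemma length_refl_lt w b : w \in W -> pos b -> ~~ pos (w^-1 b) ->
  (length (w * root_refl b) < length w)%N.
Proof.
move=> wW pb; have [c sc wE] := lengthP wW; rewrite {1 2}wE => nb.
have [c' sc' ->] := word_exchange pb nb.
by rewrite -sc sc' ltnS length_word.
Qed.

Lemma length_refl_gt w b : w \in W -> pos b -> pos (w^-1 b) ->
  (length w < length (w * root_refl b))%N.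
Proof.
move=> wW pb pwb; rewrite -{1}[w](mulgK (root_refl b)) root_reflV.
apply: length_refl_lt; rewrite ?groupM ?root_refl_weyl //.
rewrite invMg permM root_reflV -/(root_opp b) weyl_opp ?groupV //.
by rewrite pos_opp pwb.
Qed.

Lemma length_up w k : w \in W -> pos (w (Delta k)) ->
  length (s k * w) = (length w).+1.
Proof.
move=> wW pw; apply/eqP; rewrite eqn_leq length_mull // conjgC weyl_conj //.
by apply: length_refl_gt; rewrite // permK pos_simple.
Qed.

Lemma length_down w k : w \in W -> ~~ pos (w (Delta k)) ->
  length w = (length (s k * w)).+1.
Proof.
move=> wW pw; rewrite -{1}[w](mulKg (s k)) root_reflV; apply: length_up.
  by rewrite groupM ?root_refl_weyl.
by rewrite permM -/(root_opp _) weyl_opp // pos_opp.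
Qed.

Lemma strong_edge_root u v t : u \in W -> strong_edge Delta u v t ->
  exists b, [/\ pos b, pos (u^-1 b), t = root_refl b & v = u * root_refl b].
Proof.
move=> uW /and3P[/imsetP[b0 _ ->] /eqP vE /eqP lv].
wlog pb : b0 vE / pos b0 => [hw|].
  have [/(hw b0 vE)//|nb] := boolP (pos b0).
  have := hw (root_opp b0); rewrite root_refl_opp; apply=> //.
  by rewrite pos_opp.
exists b0; split=> //; apply: contraT => nb.
by have := length_refl_lt uW pb nb; rewrite -vE lv ltnNge leqnSn.
Qed.

Lemma connect_length (e : rel {perm Phi}) u v :
  (forall x y, e x y -> length y = (length x).+1) -> connect e u v ->
  u = v \/ (length u < length v)%N.
Proof.
move=> eP /connectP[p ep ->]; elim: p u ep => [|x p IH] u /=; first by left.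
case/andP => /eP ux /IH h; right; case: h => [<-|]; first by rewrite ux.
by rewrite ux; apply: ltn_trans.
Qed.

Lemma strong_le_length u v : strong_le Delta u v ->
  u = v \/ (length u < length v)%N.
Proof.
by apply: connect_length => x y /existsP[t /and3P[_ _ /eqP]].
Qed.

Lemma weak_le_length u v : weak_le Delta u v ->
  u = v \/ (length u < length v)%N.
Proof.
by apply: connect_length => x y /existsP[t /and3P[_ _ /eqP]].
Qed.

Lemma min_coset_repsP (J : {set 'I_n}) w :
  reflect (w \in W /\ forall k, k \in J -> pos (w^-1 (Delta k)))
    (w \in min_coset_reps Delta J).
Proof.
rewrite inE; apply: (iffP andP) => [[wW /forall_inP h]|[wW h]]; split=> //.
  move=> k /h /andP[nw /strong_le_length[/eqP|lt_w]];
    first by rewrite (negbTE nw).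
  apply: contraT => np; have := length_refl_lt wW (pos_simple Delta k) np.
  by rewrite ltnNge ltnW.
apply/forall_inP => k /h pk; have := length_refl_gt wW (pos_simple Delta k) pk.
move=> lt_w; apply/andP; split.
  by apply: contraTneq lt_w => {1}->; rewrite ltnn.
apply: connect1; apply/existsP; exists (s k); apply/and3P; split=> //.
  exact: imset_f.
by rewrite eqn_leq length_mulr.
Qed.

Lemma weak_edge_strong u v x :
  u \in W -> weak_edge Delta u v x -> strong_edge Delta u v (u^-1 * v).
Proof.
move=> uW /and3P[/existsP[k /eqP ->] /eqP vE lv]; apply/and3P; split=> //.
  by rewrite vE -conjgE weyl_conj // imset_f.
by rewrite mulKVg.
Qed.

Lemma weak_edgeP u v x : u \in W -> reflect
  (exists k, [/\ x = s k, v = s k * u & pos (u (Delta k))])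
    (weak_edge Delta u v x).
Proof.
move=> uW; apply: (iffP and3P) => [[/existsP[k /eqP ->] /eqP -> /eqP lv]|].
  exists k; split=> //; apply: contraT => /(length_down uW)/eqP.
  by rewrite lv -addn2 -{1}[length u]addn0 eqn_add2l.
case=> k [-> -> /(length_up uW) ->]; split=> //.
by apply/existsP; exists k.
Qed.

Lemma weak_strong_le u v : u \in W -> weak_le Delta u v -> strong_le Delta u v.
Proof.
move=> + /connectP[p ep ->]; elim: p u ep => [|x p IH] u /=.
  by move=> _ _; exact: connect0.
case/andP => /existsP[y exy] /IH h uW; apply: connect_trans (h _).
  apply: connect1; apply/existsP; exists (u^-1 * x).
  exact: weak_edge_strong exy.
by case/(weak_edgeP _ _ uW): exy => k [_ -> _];
  rewrite groupM ?simple_refl_weyl.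
Qed.

(* Evaluating both sides at a simple root and comparing its coefficients      *)
(* shows that the letter must occur on the other side.                        *)
Lemma simple_refl_mul2 (a b c e : 'I_n) : a != b -> a != c ->
  s a * s c = s b * s e -> a = e.
Proof.
move=> ab ac /(congr1 (fun w => cf Delta a (val (w (Delta a))))).
rewrite !permM !cf_simple_refl !cf_simple cartan_id eqxx.
rewrite (negbTE ab) (negbTE ac).
have [//|_] := eqVneq a e; rewrite !mulr0 !subr0 mulr1.
by rewrite -[RHS]addr0 => /addrI/eqP; rewrite oppr_eq0 pnatr_eq0.
Qed.

End Length.

(** * The maximal parabolic quotient *)

Section Quotient.
Variables (R : realFieldType) (n : nat) (Phi : root_system R n).
Variables (Delta : base Phi) (i : 'I_n).
Local Open Scope group_scope.
Implicit Types (a b g : Phi) (u v w t x : {perm Phi}) (k j : 'I_n).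
Local Notation s := (simple_refl Delta).
Local Notation W := (weyl_group Phi).
Local Notation pos := (pos Delta).
Local Notation length := (length Delta).
Local Notation Wi := (min_coset_reps1 Delta i).

Lemma min_coset_reps1P w :
  reflect (w \in W /\ forall k, k != i -> pos (w^-1 (Delta k))) (w \in Wi).
Proof.
apply: (iffP (min_coset_repsP _ _ _)) => -[wW h]; split=> // k.
  by move=> ki; apply: h; rewrite !inE.
by rewrite !inE; exact: h.
Qed.

Lemma min_rep_weyl w : w \in Wi -> w \in W.
Proof. by case/min_coset_reps1P. Qed.

(* The pairing of w omega_i with b, for omega_i dual to the simple root       *)
(* Delta i: there is no inverse on w because products of permutations compose *)
(* from left to right.                                                        *)
Definition weight w b : R := cf Delta i (val (w b)).

Lemma weightM x w b : weight (x * w) b = weight w (x b).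
Proof. by rewrite /weight permM. Qed.

Lemma weight_refl w a b : w \in W ->
  weight w (root_refl a b) =
  (weight w b - cartan (val b) (val a) * weight w a)%R.
Proof.
case/weyl_linear => M [h _]; rewrite /weight !h val_root_refl mulmxBl.
by rewrite -scalemxAl cfD cfN cfZ.
Qed.

Lemma weight_opp w a : w \in W -> weight w (root_opp a) = (- weight w a)%R.
Proof. by move=> wW; rewrite /weight weyl_opp // val_root_opp cfN. Qed.

(** Such a [b] is a nonnegative combination of the simple roots other than [Delta i], all of which
    [w^-1] keeps positive. *)
Lemma min_rep_pos w b : w \in Wi -> pos b -> cf Delta i (val b) = 0%R ->
  pos (w^-1 b).
Proof.
case/min_coset_reps1P => wW wP pb bi; apply/forallP => k.
have /weyl_linear[M [h _]] : w^-1 \in W by rewrite groupV.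
rewrite h (cf_expand Delta (val b)) mulmx_suml.
under eq_bigr do rewrite -scalemxAl -h.
rewrite cf_sum sumr_ge0 // => j _; have [->|ji] := eqVneq j i.
  by rewrite bi mul0r.
by rewrite mulr_ge0 ?cf_pos ?wP.
Qed.

Lemma weight_neg w k : w \in Wi -> ~~ pos (w (Delta k)) ->
  (weight w (Delta k) < 0)%R.
Proof.
move=> wWi nw; have wW := min_rep_weyl wWi.
rewrite lt_neqAle cf_neg // andbT; apply/eqP => w0.
have := @min_rep_pos w (root_opp (w (Delta k))) wWi.
rewrite pos_opp nw val_root_opp cfN -/(weight w _) w0 oppr0 => /(_ isT erefl).
by rewrite -weyl_opp // permK pos_opp pos_simple.
Qed.

(** Minimality can fail only if [w^-1] sends some [Delta j], [j != i], to plus or minus [Delta k],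
    and then the weight vanishes. *)
Lemma min_rep_mull w k : w \in Wi -> weight w (Delta k) != 0%R ->
  s k * w \in Wi.
Proof.
move=> wWi nz; have [wW wP] := min_coset_reps1P _ wWi.
apply/min_coset_reps1P; split=> [|j ji];
  first by rewrite groupM ?simple_refl_weyl.
rewrite invMg permM root_reflV pos_simple_reflE ?wP //.
  apply: contraNneq nz => jE; rewrite /weight -jE permKV cf_simple.
  by rewrite (eq_sym i) (negbTE ji).
apply: contraNneq nz => jE; rewrite -oppr_eq0 -weight_opp // -jE /weight permKV.
by rewrite cf_simple (eq_sym i) (negbTE ji).
Qed.

Lemma min_rep_up w k : w \in Wi -> (0 < weight w (Delta k))%R ->
  weak_edge Delta w (s k * w) (s k).
Proof.
move=> /min_rep_weyl wW gt0; apply/weak_edgeP => //; exists k; split=> //.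
exact: pos_cf_gt0 gt0.
Qed.

Lemma min_rep_down w k : w \in Wi -> (weight w (Delta k) < 0)%R ->
  weak_edge Delta (s k * w) w (s k).
Proof.
move=> /min_rep_weyl wW lt0.
have skW : s k * w \in W by rewrite groupM ?simple_refl_weyl.
apply/weak_edgeP => //; exists k; split=> //.
  by rewrite mulgA root_refl_invol mul1g.
rewrite permM -/(root_opp _) weyl_opp // pos_opp.
exact: cf_lt0_neg lt0.
Qed.

Lemma min_rep_lower u v x : u \in W -> v \in Wi -> weak_edge Delta u v x ->
  u \in Wi.
Proof.
move=> uW vWi /(weak_edgeP _ _ _ uW)[k [_ vE pk]].
have [_ vP] := min_coset_reps1P _ vWi.
apply/min_coset_reps1P; split=> // j /vP.
rewrite vE invMg permM root_reflV.
have [->|nk] := eqVneq (u^-1 (Delta j)) (Delta k); first by rewrite pos_simple.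
rewrite pos_simple_reflE //; apply: contraTneq pk => jE.
by rewrite -[Delta k]root_oppK -jE weyl_opp // permKV pos_opp pos_simple.
Qed.

Lemma weak_le_lower u v : u \in W -> v \in Wi -> weak_le Delta u v -> u \in Wi.
Proof.
move=> + + /connectP[p ep vE]; rewrite {v}vE.
elim: p u ep => [|x p IH] u //= /andP[/existsP[y uy] /IH h] uW vWi.
apply: (min_rep_lower uW _ uy); apply: h => //.
by case/(weak_edgeP _ _ _ uW): uy => k [_ -> _];
  rewrite groupM ?simple_refl_weyl.
Qed.

Lemma simple_pos_id w : w \in W -> (forall k, pos (w (Delta k))) -> w = 1.
Proof.
move=> wW wP; have [[|k c] sc wE] := lengthP Delta wW;
  first by rewrite wE big_nil.
have := length_word Delta c;
  rewrite -[\prod_(k <- c) _](mulKg (s k)) root_reflV.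
rewrite -[s k * \prod_(j <- c) s j](big_cons 1 _ _ _ xpredT) -wE.
by rewrite (length_up wW (wP k)) -sc /= ltnNge leqnSn.
Qed.

(** On [W^i] a left descent is seen as a negative weight ([weight_neg]), so [u] and [v] share their
    descents; strip one and induct on length. *)
Lemma weight_inj u v : u \in Wi -> v \in Wi -> weight u =1 weight v -> u = v.
Proof.
have [N] := ubnP (length u); elim: N u v => // N IH u v /ltnSE leN uWi vWi uv.
have [uW vW] := (min_rep_weyl uWi, min_rep_weyl vWi).
have [/forallP pu|/forallPn[k nk]] := boolP [forall k, pos (u (Delta k))].
  rewrite (simple_pos_id uW pu) (simple_pos_id vW) // => k.
  apply: contraT => /(weight_neg vWi); rewrite -uv ltNge.
  by rewrite /weight cf_pos.
have lt0 := weight_neg uWi nk.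
apply: (mulgI (s k)); apply: IH.
- by rewrite -(length_down uW nk).
- by rewrite min_rep_mull // lt_eqF.
- by rewrite min_rep_mull // -uv lt_eqF.
- by move=> b; rewrite !weightM uv.
Qed.

(** * Transport of labels in [W^i] and comparison of the two orders *)

Section Distributive.
Variables (d : Order.disp_t) (L : finDistrLatticeType d).
Variable f : L -> {perm Phi}.
Hypothesis f_iso : order_iso [set: L] <=%O Wi (weak_le Delta) f.
Implicit Types y z : L.

Lemma iso_le y z : weak_le Delta (f y) (f z) = (y <= z)%O.
Proof. by case: f_iso => _ _ ->; rewrite ?inE. Qed.

Lemma iso_min_rep y : f y \in Wi.
Proof. by case: f_iso => _ <- _; rewrite imset_f ?inE. Qed.

Lemma iso_weyl y : f y \in W. Proof. exact: min_rep_weyl (iso_min_rep y). Qed.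

Lemma iso_inj : injective f.
Proof. by case: f_iso => inj _ _ y z; apply: inj; rewrite inE. Qed.

Lemma iso_surj w : w \in Wi -> exists y, w = f y.
Proof. by case: f_iso => _ <- _ /imsetP[y _ ->]; exists y. Qed.

Lemma weak_edge_le u v x : weak_edge Delta u v x -> weak_le Delta u v.
Proof. by move=> e; apply: connect1; apply/existsP; exists x. Qed.

(** A weak chain up to [f z] stays in [W^i], which is a weak lower set, so its first step already
    ends in the image of [f], between [y] and [z]. *)
Lemma covers_weak_edge y z : covers y z ->
  exists2 k, weak_edge Delta (f y) (f z) (s k) & f z = s k * f y.
Proof.
case/coversP => lt_yz h; have := ltW lt_yz;
  rewrite -iso_le => /connectP[[|v p] /=].
  move=> _ e; have : (z <= y)%O by rewrite -iso_le e; exact: connect0.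
  by rewrite (lt_geF lt_yz).
case/andP => /existsP[x yv] vp e.
have [k [xE vE _]] := weak_edgeP _ _ _ (iso_weyl y) yv.
have vz : weak_le Delta v (f z) by apply/connectP; exists p.
have vWi : v \in Wi.
  apply: weak_le_lower vz; rewrite ?iso_min_rep // vE.
  by rewrite groupM ?simple_refl_weyl ?iso_weyl.
have [y' y'E] := iso_surj vWi; rewrite y'E in yv vz vE.
have -> : z = y'.
  symmetry; apply: h; last by rewrite -iso_le.
  rewrite lt_neqAle -iso_le (weak_edge_le yv) andbT.
  apply: contraTneq yv => <-; rewrite /weak_edge negb_and negb_and.
  by rewrite [_ == _.+1]ltn_eqF ?orbT.
by exists k; rewrite -1?xE // xE.
Qed.

Lemma weak_edge_covers y z x : weak_edge Delta (f y) (f z) x -> covers y z.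
Proof.
move=> yz; have lyz : length (f z) = (length (f y)).+1.
  by case/and3P: yz => _ _ /eqP.
apply/coversP; split=> [|t].
  rewrite lt_neqAle -iso_le (weak_edge_le yz) andbT.
  by apply: contra_eq_neq lyz => ->; rewrite ltn_eqF.
rewrite lt_neqAle -!iso_le => /andP[nyt /weak_le_length[/eqP|lt1]].
  by case: f_iso => inj _ _; rewrite (inj_in_eq inj) ?inE // (negbTE nyt).
case/weak_le_length => [e|lt2].
  by case: f_iso => inj _ _; apply: inj; rewrite ?inE.
by move: lt2; rewrite lyz ltnS leqNgt lt1.
Qed.

Definition weak_label y z := f z * (f y)^-1.
Definition strong_label y z := (f y)^-1 * f z.

Lemma weak_labelE y z x : weak_edge Delta (f y) (f z) x -> weak_label y z = x.
Proof. by case/and3P => _ /eqP zE _; rewrite /weak_label zE mulgK. Qed.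

Lemma square_commute y z z' : covers y z -> covers y z' -> z != z' ->
  covers z (z `|` z')%O -> covers z' (z `|` z')%O ->
  exists k j, [/\ f z = s k * f y, f z' = s j * f y,
    f (z `|` z')%O = s k * f z', f (z `|` z')%O = s j * f z &
    s k * s j = s j * s k].
Proof.
move=> /covers_weak_edge[k ek zE] /covers_weak_edge[j ej z'E] nzz'.
move=> /covers_weak_edge[l el tE] /covers_weak_edge[m em tE'].
have kj : k != j.
  by apply: contraNneq nzz' => kj; apply/eqP/iso_inj; rewrite zE z'E kj.
(* Repeating a letter would bring the top of the square back to [y]. *)
have cancel (t : L) l' k' : (y < t)%O -> f t = s l' * (s k' * f y) -> k' != l'.
  move=> lt_yt tE''; apply: contraTneq lt_yt => kl;
    suff -> : t = y by rewrite ltxx.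
  by apply: iso_inj; rewrite tE'' kl mulgA root_refl_invol mul1g.
have lt_yz : (y < z)%O by case/coversP: (weak_edge_covers ek).
have lt_yt : (y < z `|` z')%O by apply: lt_le_trans lt_yz _; exact: leUl.
have kl : k != l by apply: cancel lt_yt _; rewrite -zE.
have jm : j != m by apply: cancel lt_yt _; rewrite -z'E.
have sE : s l * s k = s m * s j.
  by apply: (mulIg (f y)); rewrite -!mulgA -zE -z'E -tE.
have sE' : s k * s l = s j * s m.
  by apply: invg_inj; rewrite !invMg !root_reflV.
have km : k = m by apply: simple_refl_mul2 sE'.
have jl : j = l by apply: simple_refl_mul2 (esym sE'); rewrite // eq_sym.
by exists k, j; rewrite -jl in tE sE; rewrite -km in tE' sE.
Qed.

Lemma weak_label_square y z z' : covers y z -> covers y z' -> z != z' ->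
  covers z (z `|` z')%O -> covers z' (z `|` z')%O ->
  weak_label y z = weak_label z' (z `|` z')%O.
Proof.
move=> c1 c2 nz c3 c4;
  have [k [j [zE z'E tE _ _]]] := square_commute c1 c2 nz c3 c4.
by rewrite /weak_label tE zE !mulgK.
Qed.

Lemma strong_label_square y z z' : covers y z -> covers y z' -> z != z' ->
  covers z (z `|` z')%O -> covers z' (z `|` z')%O ->
  strong_label y z = strong_label z' (z `|` z')%O.
Proof.
move=> c1 c2 nz c3 c4;
  have [k [j [zE z'E _ tE kj]]] := square_commute c1 c2 nz c3 c4.
by rewrite /strong_label tE z'E invMg -mulgA mulKg.
Qed.

(** If [s k * u] is not below [v], then [x] is their join, and transport gives the cover from their
    meet to [s k * u] the label [s k]; hence the meet is [u]. *)
Lemma weak_le_cancel_up k u v x : u \in Wi -> s k * u \in Wi -> v \in Wi ->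
  x \in Wi -> weak_edge Delta u (s k * u) (s k) -> weak_le Delta (s k * u) x ->
  weak_edge Delta v x (s k) -> weak_le Delta u v.
Proof.
move=> /iso_surj[a ->] /iso_surj[b bE] /iso_surj[c ->] /iso_surj[e ->].
rewrite bE => ab; rewrite !iso_le => be ce.
have [ca cc] := (weak_edge_covers ab, weak_edge_covers ce).
have [/coversP[lt_ab _] /coversP[lt_ce he]] := (ca, cc).
have [bc|nbc] := boolP (b <= c)%O; first exact: le_trans (ltW lt_ab) bc.
have jE : (c `|` b)%O = e.
  apply: he; last by rewrite leUx be ltW.
  by rewrite lt_def leUl andbT; apply: contraNneq nbc => <-; exact: leUr.
have cI : covers (b `&` c)%O b by apply: meet_covers; rewrite joinC jE.
have := lab_transport weak_label_square cI (leIr _ _) nbc.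
rewrite jE (weak_labelE ce) -(weak_labelE ab) /weak_label => /mulgI/invg_inj.
by move=> /iso_inj ->; exact: leIr.
Qed.

(** If [v] is not below [x], the join of the two covers [x] with the transported label [s k], so it
    is [v']. *)
Lemma weak_le_cancel_down k u v x v' : u \in Wi -> v \in Wi -> x \in Wi ->
  v' \in Wi -> weak_edge Delta u v (s k) -> weak_le Delta u x ->
  weak_edge Delta x v' (s k) -> weak_le Delta v v'.
Proof.
move=> /iso_surj[a ->] /iso_surj[b ->] /iso_surj[c ->] /iso_surj[e ->] ab.
rewrite !iso_le => ac ce.
have [/coversP[lt_ce _]] := weak_edge_covers ce.
have [bc|nbc] := boolP (b <= c)%O; first exact: le_trans bc (ltW lt_ce).
have := lab_transport weak_label_square (weak_edge_covers ab) ac nbc.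
rewrite (weak_labelE ab) -(weak_labelE ce) /weak_label => /mulIg.
by move=> /iso_inj <-; exact: leUr.
Qed.

Lemma weak_le_reflection g : pos g ->
  forall w, w \in Wi -> (0 < weight w g)%R ->
  exists w', [/\ w' \in Wi, weak_le Delta w w' &
    forall b, weight w' b = weight w (root_refl g b)].
Proof.
move: g; apply: (@pos_root_ind _ _ _ Delta) =>
    [k w wWi gt0|g k pg pkg gk IH w wWi gt0].
  exists (s k * w); split=> [||b]; last exact: weightM.
    by apply: min_rep_mull; rewrite // gt_eqF.
  by apply: weak_edge_le; apply: min_rep_up.
have wW := min_rep_weyl wWi.
set m := weight w (Delta k).
have refl0 x b : x \in W -> weight x (Delta k) = 0%R ->
    weight x (s k b) = weight x b.
  by move=> xW x0; rewrite weight_refl // x0 mulr0 subr0.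
(* At weight 0, [s k] fixes the weight of [w], so [w] itself represents the reflected weight. *)
pose w1 := if m == 0%R then w else s k * w.
have w1Wi : w1 \in Wi.
  by rewrite /w1; case: ifPn => // m0; exact: min_rep_mull.
have w1E b : weight w1 b = weight w (s k b).
  by rewrite /w1; case: ifPn => [/eqP m0|_]; [rewrite refl0|exact: weightM].
have [||w2 [w2Wi w12 w2E]] := IH w1; rewrite ?w1E ?root_reflK //.
have w2W := min_rep_weyl w2Wi.
have {}w2E b : weight w2 b = weight w (root_refl g (s k b)).
  by rewrite w2E w1E weyl_refl ?simple_refl_weyl // root_reflK.
have w2k : weight w2 (Delta k) =
    (cartan (val (Delta k)) (val g) * weight w g - m)%R.
  rewrite w2E -/(root_opp _) weyl_opp ?root_refl_weyl // weight_opp //.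
  by rewrite weight_refl // opprB.
(* Hence [m] and the pairing of [w2] with [Delta k] have a positive sum: the two outer steps cannot
   both go down, and a lone step down meets a step up by the same letter or none at all. *)
have Cgt0 : (0 < cartan (val (Delta k)) (val g) * weight w g)%R.
  by rewrite mulr_gt0 // cartan_gt0 dotC.
pose w' := if weight w2 (Delta k) == 0%R then w2 else s k * w2.
have w'Wi : w' \in Wi.
  by rewrite /w'; case: ifPn => // n0; exact: min_rep_mull.
exists w'; split=> // [|b]; last first.
  rewrite /w'; case: ifPn => [/eqP n0|_];
    last by rewrite weightM w2E root_reflK.
  by rewrite -(refl0 _ _ w2W n0) w2E root_reflK.
case: (ltgtP m 0%R) => [m0|m0|m0].
- have n0 : (0 < weight w2 (Delta k))%R by rewrite w2k subr_gt0 (lt_trans m0).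
  have w1k : w1 = s k * w by rewrite /w1 lt_eqF.
  have w'k : w' = s k * w2 by rewrite /w' gt_eqF.
  apply: (@weak_le_cancel_down k w1 _ w2) => //;
    first by rewrite w1k min_rep_down.
  by rewrite w'k min_rep_up.
- have w1k : w1 = s k * w by rewrite /w1 gt_eqF.
  have ww1 : weak_edge Delta w w1 (s k) by rewrite w1k min_rep_up.
  have ww2 := connect_trans (weak_edge_le ww1) w12.
  rewrite /w'; case: ltgtP => n0 //.
    apply: (@weak_le_cancel_up k w _ w2); rewrite -?w1k //.
      by rewrite min_rep_mull // lt_eqF.
    exact: min_rep_down.
  by apply: connect_trans ww2 _; apply: weak_edge_le; exact: min_rep_up.
- have n0 : (0 < weight w2 (Delta k))%R by rewrite w2k m0 subr0.
  have -> : w' = s k * w2 by rewrite /w' gt_eqF.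
  have w1k : w1 = w by rewrite /w1 m0 eqxx.
  rewrite w1k in w12; apply: connect_trans w12 _.
  by apply: weak_edge_le; exact: min_rep_up.
Qed.

Lemma strong_weak_le u v : u \in Wi -> v \in Wi -> strong_le Delta u v ->
  weak_le Delta u v.
Proof.
move=> uWi vWi /connectP[p ep vE].
(* The chain vertex [x] may lie outside [W^i]; it is shadowed by [w] in [W^i] of the same weight. *)
suff /(_ u u (min_rep_weyl uWi) ep uWi (fun _ => erefl)) [w' [w'Wi uw' w'E]] :
    forall x w, x \in W ->
    path (fun u v => [exists t, strong_edge Delta u v t]) x p ->
    w \in Wi -> weight w =1 weight x ->
    exists w', [/\ w' \in Wi, weak_le Delta w w'
      & weight w' =1 weight (last x p)].
  by rewrite -(weight_inj w'Wi vWi) // vE.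
elim: p {u v ep vE uWi vWi} => [|x p IH] u w uW /=.
  by exists w; split=> //; exact: connect0.
case/andP => /existsP[t /(strong_edge_root uW)[b [pb pub _ xE]]] xp wWi wu.
have xW : x \in W by rewrite xE groupM ?root_refl_weyl.
have xwt c : weight x c = weight w (root_refl (u^-1 b) c).
  by rewrite wu xE weightM /weight weyl_refl // permKV.
have : (0 <= weight w (u^-1 b)%g)%R by rewrite wu /weight permKV cf_pos.
rewrite le_eqVlt => /predU1P[w0|gt0].
  apply: (IH x w) => // c.
  by rewrite xwt weight_refl ?(min_rep_weyl wWi) // -w0 mulr0 subr0.
have [w1 [w1Wi ww1 w1E]] := weak_le_reflection pub wWi gt0.
have [|w' [w'Wi ? ?]] := IH x w1 xW xp w1Wi; first by move=> c; rewrite w1E xwt.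
by exists w'; split=> //; apply: connect_trans ww1 _.
Qed.

End Distributive.
End Quotient.

Theorem theorem6p2 (R : realFieldType) (n : nat) (Phi : root_system R n)
    (Delta : base Phi) (i : 'I_n) :
  irreducible_root_system Phi ->
  is_distributive_lattice (min_coset_reps1 Delta i) (weak_le Delta) ->
  [/\ {in min_coset_reps1 Delta i &,
        forall u v, strong_le Delta u v = weak_le Delta u v},
      distributively_labeled_lattice (min_coset_reps1 Delta i) (weak_le Delta)
        (weak_edge Delta)
    & distributively_labeled_lattice (min_coset_reps1 Delta i) (strong_le Delta)
        (strong_edge Delta)].
Proof.
move=> _ [d [L [f f_iso]]].
have le_eq : {in min_coset_reps1 Delta i &,
    forall u v, strong_le Delta u v = weak_le Delta u v}.
  move=> u v uWi vWi; apply/idP/idP; first exact: (strong_weak_le f_iso).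
  exact: weak_strong_le (min_rep_weyl uWi).
(* The identity lies in [W^i], so [L] is inhabited and has a bottom. *)
have [x0 _] : exists x0, 1%g = f x0.
  apply: (iso_surj f_iso); apply/min_coset_reps1P; split=> [|k _];
    first exact: group1.
  by rewrite invg1 perm1 pos_simple.
have [bot bot_le] := finite_bottom x0.
split=> //.
  apply: (birkhoff_labeled bot_le f_iso (lab := weak_label f)).
    move=> x y /(covers_weak_edge f_iso)[k ek _].
    by rewrite (weak_labelE ek).
  exact: (weak_label_square f_iso).
have f_iso' :
    order_iso [set: L] <=%O (min_coset_reps1 Delta i) (strong_le Delta) f.
  case: (f_iso) => f_inj f_im f_mono; split=> // x y xL yL.
  by rewrite le_eq ?f_mono // (iso_min_rep f_iso).
apply: (birkhoff_labeled bot_le f_iso' (lab := strong_label f)).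
  move=> x y /(covers_weak_edge f_iso)[k ek _].
  exact: weak_edge_strong (iso_weyl f_iso x) ek.
exact: (strong_label_square f_iso).
Qed.
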